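(* Let $n\ge2$ and integers $n_1,\dots,n_\ell\ge2$ with $n_1\cdots n_\ell=n$, and let $U=F_{(n_1,\dots,n_\ell)}=F_{n_1}\otimes\cdots\otimes F_{n_\ell}$. Then: (1) With a suitable labelling of the modes (i.e. after a change of basis by a permutation matrix), every entry of the first row of $U$ equals $1/\sqrt n$. (2) $U$ has a symmetry group $G$ isomorphic to $\mathbb Z_{n_1}\times\cdots\times\mathbb Z_{n_\ell}$, i.e. an abelian group $G$ of $n\times n$ permutation matrices with this isomorphism type such that for each $P\in G$ there is a diagonal matrix $D_P$ with $UP=D_PU$. (3) $G$ acts transitively on the $n$ modes. In particular, up to first order in $\epsilon$, the heralding rate and output error rate of the distillation protocol with $U=F_{(n_1,\dots,n_\ell)}$ depend only on $n$.
   Context: $F_m=\frac1{\sqrt m}(e^{2\pi ijk/m})_{0\le j,k\le m-1}$; $\mathbb Z_m$ is the cyclic group of order $m$. Modes are the standard basis vectors of $\mathbb C^n\cong\mathbb C^{n_1}\otimes\cdots\otimes\mathbb C^{n_\ell}$, and permutation matrices permute modes. Distillation protocol for an $n\times n$ unitary $U$: $n$ photons, one in each mode, each with internal state in a space with orthonormal basis $\{\xi_0,\xi_1,\dots\}$, the photon in mode $i$ independently in $\xi_0$ with probability $1-\epsilon$ and otherwise in an error state $\xi_j$, $j\ge1$ (uniform random source model: each of $\xi_1,\dots,\xi_R$ with probability $\epsilon/R$; or orthogonal-bad-bits limit: $\xi_{i+1}$ with probability $\epsilon$). Apply the induced linear optical unitary $\hat U$ ($a_j^\dagger[\xi]\mapsto\sum_iU_{ij}a_i^\dagger[\xi]$),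 count photons in modes $1,\dots,n-1$, set $s_0=n-\sum_{j\ge1}s_j$, and herald success iff $s_0=1$ and $\langle s_0,\dots,s_{n-1}|\hat U|1,\dots,1\rangle\ne0$ (an ideal pattern). The heralding rate $h_n(\epsilon)$ is the success probability; the output error rate $e_n(\epsilon)$ is the conditional probability given success that the photon in mode $0$ has internal state $\xi_i$, $i\ge1$. Mode $0$ is the mode labelled so that (1) holds. *)

(* Defs.v *)
From HB Require Import structures.
From mathcomp Require Import all_boot all_order all_algebra all_fingroup all_solvable all_field.
From mathcomp Require Import mxtens.
Set Implicit Arguments. Unset Strict Implicit. Unset Printing Implicit Defensive.
Import Order.TTheory GRing.Theory Num.Theory.
Local Open Scope ring_scope.

(* n = n_1 * ... * n_l, computed by a fold so that it is definitionally
   compatible with the recursive Kronecker product below. *)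
Definition prodn (s : seq nat) : nat := foldr muln 1%N s.

(* e^{2 pi i / m}:  m.-root (-1) is e^{i pi / m} (root of minimal argument). *)
Definition omega (m : nat) : algC := (m.-root (-1)) ^+ 2.

Definition Fmx (m : nat) : 'M[algC]_m :=
  \matrix_(j, k) (omega m ^+ (j * k)%N / sqrtC m%:R).

Fixpoint Ften (s : seq nat) : 'M[algC]_(prodn s) :=
  match s return 'M[algC]_(prodn s) with
  | [::] => 1%:M
  | m :: s' => tensmx (Fmx m) (Ften s')
  end.

(* Relabelling of the modes by a permutation: new mode i = old mode sigma i,
   i.e. the change of basis P U P^T with P the permutation matrix of sigma. *)
Definition relabel n (sigma : 'S_n) (U : 'M[algC]_n) : 'M[algC]_n :=
  perm_mx sigma *m U *m (perm_mx sigma)^T.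

Section Protocol.
Variable n : nat.
Implicit Types (U : 'M[algC]_n) (f : 'I_n -> 'I_n) (c : 'I_n -> nat).

(* Permanent of the submatrix of U with rows f a (a in A, with repetition)
   and columns A (input modes of the photons in A). *)
Definition per_on U (A : {set 'I_n}) f : algC :=
  \sum_(tau : 'S_n | perm_on A tau) \prod_(a in A) U (f a) (tau a).

(* Probability weight of the assignment f (photon from input mode i ends in
   output mode f i), given the internal-state labels c of the photons:
   photons with equal labels are indistinguishable, different labels are
   orthogonal (distinguishable).  For each label class A of size k, the
   probability of an output pattern t is |Per U[t,A]|^2 / prod t!, which equals
   (1/k!) * sum over the k!/prod t! assignments with pattern t of |Per|^2. *)
Definition out_weight U c f : algC :=
  \prod_(v <- undup [seq c i | i <- enum 'I_n])
     (`|per_on U [set i | c i == v] f| ^+ 2 / (#|[set i | c i == v]|`!)%:R).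

(* <s|U^|1,...,1> is Per(U[s, all]) / sqrt(prod s!), nonzero iff the
   permanent is nonzero; it only depends on the pattern of f. *)
Definition ideal_pattern U f : bool := per_on U [set: 'I_n] f != 0.

Definition success U (m0 : 'I_n) f : bool :=
  (#|[set i | f i == m0]| == 1%N) && ideal_pattern U f.

Definition out_error c (m0 : 'I_n) f : bool :=
  [exists i, (f i == m0) && (c i != 0%N)].

Definition succ_prob U m0 c : algC :=
  \sum_(f : {ffun 'I_n -> 'I_n} | success U m0 f) out_weight U c f.

Definition succ_err_prob U m0 c : algC :=
  \sum_(f : {ffun 'I_n -> 'I_n} | success U m0 f && out_error c m0 f)
     out_weight U c f.

(* Source models.  Probabilities are polynomials in eps ('X). *)
Inductive source := OBB | Uniform of nat.

Definition valid_source (src : source) : bool :=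
  if src is Uniform R then (0 < R)%N else true.

(* orthogonal-bad-bits: photon i in xi_0 w.p. 1-eps, else in xi_{i+1}. *)
Definition obb_label (E : {set 'I_n}) (i : 'I_n) : nat :=
  if i \in E then i.+1 else 0%N.

Definition weighted (src : source) (F : ('I_n -> nat) -> algC) : {poly algC} :=
  match src with
  | OBB =>
      \sum_(E : {set 'I_n})
         'X ^+ #|E| * (1 - 'X) ^+ (n - #|E|) * (F (obb_label E))%:P
  | Uniform R =>
      \sum_(c : {ffun 'I_n -> 'I_R.+1})
         (\prod_(i : 'I_n) (if c i == ord0 then 1 - 'X else (R%:R)^-1 *: 'X))
         * (F (fun i => nat_of_ord (c i)))%:P
  end.

Definition herald_rate src U m0 : {poly algC} := weighted src (succ_prob U m0).
(* Pr(success and error in mode m0); the output error rate is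
   e(eps) = herald_err src U m0 / herald_rate src U m0. *)
Definition herald_err src U m0 : {poly algC} := weighted src (succ_err_prob U m0).

End Protocol.

(* Agreement up to first order in eps (i.e. up to O(eps^2)) of polynomials,
   and of rational functions p1/q1, p2/q2 (cross-multiplied form). *)
Definition first_order_eq (p q : {poly algC}) : bool := 'X ^+ 2 %| (p - q).
Definition first_order_eq_ratio (p1 q1 p2 q2 : {poly algC}) : bool :=
  'X ^+ 2 %| (p1 * q2 - p2 * q1).

(* Main.v *)
Require Import Defs.
From HB Require Import structures.
From mathcomp Require Import all_boot all_order all_algebra all_fingroup all_solvable all_field.
From mathcomp Require Import mxtens ring lra.
Set Implicit Arguments. Unset Strict Implicit. Unset Printing Implicit Defensive.
Import Order.TTheory GRing.Theory Num.Theory.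
Local Open Scope ring_scope.

(* The translation group of Z_{n_1} x ... x Z_{n_l} acts transitively on the
   modes, and translating the columns of the character table rescales its rows.
   For an ideal pattern f (nonzero permanent of U_f) the symmetries force the
   Laplace terms of this permanent along any row to be equal.  The weight of f
   when one photon is distinguishable is therefore 1/n times its error-free
   weight.  The total error-free weight of the patterns where a prescribed
   photon is the only one in mode 0 is computed by expanding |per|^2: the other
   modes are summed out by orthonormality of the columns, and only row 0
   remains.  So the success probabilities for at most one error, and the rates
   up to first order, depend on n alone. *)

(** * Primitive roots of unity *)

(* Rotating a point (a, b) of the upper half circle clockwise by twice the
   argument of (p, q) increases its abscissa when (p, q) lies to its right. *)
Lemma unit_circle_rotation (R : realFieldType) (a b p q : R) :
  a ^+ 2 + b ^+ 2 = 1 -> p ^+ 2 + q ^+ 2 = 1 -> 0 <= b -> 0 < q -> a < p ->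
  a < a * (p ^+ 2 - q ^+ 2) + 2%:R * p * q * b.
Proof.
move=> ab1 pq1 b_ge0 q_gt0 lt_ap; rewrite ltNge; apply/negP => le_rot.
(* [p * b - a * q] is the sine of the angle from (p, q) to (a, b). By [le_rot] it is at most 0,
   which the factorization [dsq] refutes in each sign case of [p + a]. *)
have le_pb : p * b <= a * q.
  rewrite -(ler_pM2l q_gt0).
  have p2 : p ^+ 2 = 1 - q ^+ 2 by lra.
  by rewrite p2 in le_rot; lra.
have dsq : (p * b - a * q) * (p * b + a * q) = (p - a) * (p + a).
  have b2 : b ^+ 2 = 1 - a ^+ 2 by lra.
  have q2 : q ^+ 2 = 1 - p ^+ 2 by lra.
  by rewrite -!subr_sqr !exprMn b2 q2; ring.
have [pa_gt0 | pa_le0] := ltP 0 (p + a).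
  have : 0 < (p * b - a * q) * (p * b + a * q) by rewrite dsq; nra.
  have pb_ge0 : 0 <= p * b by apply: mulr_ge0 => //; lra.
  nra.
have a_lt0 : a < 0 by lra.
have aq_lt0 : a * q < 0 by nra.
have p_lt0 : p < 0 by nra.
have : (p * b - a * q) * (p * b + a * q) < 0 by rewrite dsq; nra.
have pb_le0 : p * b <= 0 by nra.
nra.
Qed.

Lemma Re_le_rotation_eq (z w : algC) :
    `|z| = 1 -> `|w| = 1 -> 0 <= 'Im z -> 0 < 'Im w -> 'Re z <= 'Re w ->
  'Re (z * (w^*) ^+ 2) <= 'Re z -> z = w.
Proof.
move=> z1 w1 Iz Iw le_zw le_rot.
apply: eqC_semipolar; [by rewrite z1 | | by rewrite mulr_ge0 // ltW].
apply/eqP; move: le_zw; rewrite le_eqVlt => /orP[//|lt_zw].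
pose re x := in_algR (Creal_Re x); pose im x := in_algR (Creal_Im x).
have n1 (x : algC) : `|x| = 1 -> re x ^+ 2 + im x ^+ 2 = 1.
  move=> x1; apply: val_inj; change (algRval (re x ^+ 2 + im x ^+ 2) = 1).
  by rewrite rmorphD !rmorphXn /= -normC2_Re_Im x1 expr1n.
have := @unit_circle_rotation _ _ _ _ _ (n1 _ z1) (n1 _ w1) Iz Iw lt_zw.
set rot := (X in _ < X) => lt_rot.
suffices rotE : algRval rot = 'Re (z * w^* ^+ 2).
  by move: lt_rot; rewrite ltNge => /negP[]; rewrite -rotE in le_rot.
rewrite /rot !(rmorphD, rmorphB, rmorphM, rmorphXn, rmorph_nat) /=.
by rewrite ReM expr2 ReM ImM !Re_conj !Im_conj; ring.
Qed.

(* For y ^+ m = -1, let x be the rotation of y by a power of w ^+ 2 with the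
   largest real part: a further rotation by w ^+ 2 or its inverse cannot
   increase it, so x is w or its conjugate.  Hence all m roots of -1 lie in a
   single coset of the group generated by w ^+ 2. *)
Lemma prim_root_omega (m : nat) : (1 < m)%N -> m.-primitive_root (omega m).
Proof.
move=> m_gt1; have m_gt0 := ltnW m_gt1; rewrite /omega.
set w := m.-root (-1).
have wm : w ^+ m = -1 by rewrite rootCK.
have norm1 (y : algC) : y ^+ m = -1 -> `|y| = 1.
  by move=> ym; apply/eqP; rewrite -(@pexpr_eq1 _ _ m) // -normrX ym normrN1.
have w1 := norm1 _ wm.
have wV : w^* = w^-1 by rewrite invC_norm w1 expr1n invr1 mul1r.
have w_neq0 : w != 0 by rewrite -normr_eq0 w1 oner_eq0.
have Iw : 0 < 'Im w.
  rewrite lt_def Im_rootC_ge0 // andbT; apply/eqP => /Creal_ImP Rw.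
  have := real_normK Rw; rewrite w1 expr1n => /esym/eqP; rewrite sqrf_eq1.
  case/orP => /eqP ew; first by move/eqP: wm; rewrite ew expr1n -addr_eq0 (pnatr_eq0 _ 2).
  by have := rootC_lt0 (-1 : algC) m_gt1; rewrite -/w ew ltrN10.
(* [rootC_Re_max] handles roots in the closed upper half plane; the others are conjugated first. *)
have Re_max (y : algC) : y ^+ m = -1 -> 'Re y <= 'Re w.
  move=> ym; have [Iy|Iy] := real_leP (rpred0 _) (Creal_Im y).
    exact: rootC_Re_max.
  rewrite -Re_conj; apply: rootC_Re_max => //.
    by rewrite -rmorphXn /= ym rmorphN1.
  by rewrite Im_conj oppr_ge0 ltW.
have wm1 : (w ^+ 2) ^+ m = 1 by rewrite exprAC wm sqrrN expr1n.
have [k prim_k k_dvd] := prim_order_exists m_gt0 wm1.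
(* Applied to [w * z] with [z] a primitive [m]-th root of unity, this makes [z] a power of [w ^+ 2],
   so [m] divides its order [k]. *)
suffices cover (y : algC) : y ^+ m = -1 -> exists j, y = w * (w ^+ 2) ^+ j.
  have [z prim_z] := C_prim_root_exists m_gt0.
  have [|j] := cover (w * z); first by rewrite exprMn wm (prim_expr_order prim_z) mulr1.
  move/(mulfI w_neq0) => Dz.
  have : (m %| k)%N.
    by rewrite (prim_order_dvd prim_z) Dz (exprAC (w ^+ 2)) (prim_expr_order prim_k) expr1n.
  by move=> m_dvd; have /eqP <- : k == m by rewrite eqn_dvd k_dvd.
move=> ym.
pose F (j : 'I_m) := 'Re (y * (w ^+ 2) ^+ j).
pose i0 := Ordinal m_gt0.
case: (@real_arg_maxP _ _ i0 xpredT F isT); first by move=> j _; apply: Creal_Re.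
move=> i _ imax.
have {}imax j : 'Re (y * (w ^+ 2) ^+ j) <= 'Re (y * (w ^+ 2) ^+ i).
  have := imax (Ordinal (ltn_pmod j m_gt0)) isT; rewrite /F /=.
  by rewrite expr_mod.
set x := y * _ in imax.
have xm : x ^+ m = -1 by rewrite exprMn ym (exprAC (w ^+ 2)) wm1 expr1n mulr1.
have x1 := norm1 _ xm.
(* [imax] covers natural exponents only, so the backward rotation is written as a forward one. *)
have wVm : (w^-1) ^+ 2 = (w ^+ 2) ^+ m.-1.
  apply: (@mulfI _ (w ^+ 2)); first by rewrite expf_neq0.
  by rewrite -exprMn mulfV // expr1n -exprS prednK.
have yx : y = x * (w ^+ 2) ^+ (m - i).
  by rewrite /x -mulrA -exprD subnKC 1?ltnW // wm1 mulr1.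
have [Ix|Ix] := real_leP (rpred0 _) (Creal_Im x).
  exists (m - i)%N; rewrite {1}yx; congr (_ * _).
  apply: Re_le_rotation_eq => //; first exact: Re_max.
  by rewrite wV wVm -mulrA -exprD.
have Dx : x^* = w.
  apply: Re_le_rotation_eq; rewrite ?norm_conjC //.
  - by rewrite Im_conj oppr_ge0 ltW.
  - by rewrite Re_conj; apply: Re_max.
  - by rewrite -rmorphXn -rmorphM /= !Re_conj -mulrA -exprSr.
exists (m - i + m.-1)%N; rewrite {1}yx -[x]conjCK Dx exprD -wVm wV.
by rewrite expr2; field.
Qed.

(** * Permanents of symmetric unitaries *)

Definition column_symmetry n (U : 'M[algC]_n) (p : 'S_n) : Prop :=
  exists d : 'I_n -> algC, forall i x, U i (p x) = d i * U i x.

(** Besides the row [m0], these are the only properties of the unitary that enter the first-order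
    rates. *)
Definition flat_symmetric n (U : 'M[algC]_n) : Prop :=
  [/\ forall x y, \sum_j U j x * (U j y)^* = (x == y)%:R,
      forall i j, `|U i j| ^+ 2 = n%:R^-1
    & forall j k, exists p : 'S_n, p j = k /\ column_symmetry U p].

Lemma per_on_setT n (U : 'M[algC]_n) f :
  per_on U [set: 'I_n] f = \sum_(t : 'S_n) \prod_a U (f a) (t a).
Proof.
rewrite /per_on; apply: eq_big => [t | t _]; last first.
    by apply: eq_bigl => a; rewrite inE.
  by apply/subsetP => x _; rewrite inE.
Qed.

(** Permutations fixing [i] are those supported on its complement, so the sum is one Laplace term of
    the permanent. *)
Lemma sum_perm_fix n (U : 'M[algC]_n) f i :
  \sum_(t : 'S_n | t i == i) \prod_a U (f a) (t a)
  = U (f i) i * per_on U [set~ i] f.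
Proof.
rewrite /per_on mulr_sumr; apply: eq_big => [t | t /eqP ti].
  rewrite /perm_on; apply/eqP/subsetP => [ti x | sub].
    by rewrite !inE; apply: contraNneq => ->; rewrite ti.
  by apply/eqP; have := sub i; rewrite !inE eqxx; case: eqP => // _ /(_ isT).
by rewrite (bigD1 i) //= ti; congr (_ * _); apply: eq_bigl => a; rewrite !inE.
Qed.

(* A symmetry P of U multiplies per(U_f) by the product of the d_(f a), so this
   product is 1 when per(U_f) != 0; the Laplace terms along row i, permuted
   transitively by the symmetries, are then all equal. *)
Lemma per_ideal n (U : 'M[algC]_n) f i : flat_symmetric U -> ideal_pattern U f ->
  per_on U [set: 'I_n] f = n%:R * (U (f i) i * per_on U [set~ i] f).
Proof.
move=> [_ _ symU]; rewrite /ideal_pattern per_on_setT => per_neq0.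
pose T j := \sum_(t : 'S_n | t i == j) \prod_a U (f a) (t a).
have shift (p : 'S_n) d : (forall i x, U i (p x) = d i * U i x) ->
    forall t : 'S_n, \prod_a U (f a) ((t * p)%g a) =
                     \prod_a d (f a) * \prod_a U (f a) (t a).
  move=> Up t; rewrite -big_split /=; apply: eq_bigr => a _.
  by rewrite permM Up.
have Tconst j : T j = T i.
  have [p [<- [d Up]]] := symU i j.
  have d1 : \prod_a d (f a) = 1.
    apply: (mulIf per_neq0); rewrite mul1r mulr_sumr [RHS](reindex_inj (mulIg p)).
    by apply: eq_bigr => t _; rewrite (shift p d).
  rewrite /T (reindex_inj (mulIg p)) /=; apply: eq_big => [t | t _].
    by rewrite permM (inj_eq perm_inj).
  by rewrite (shift p d) // d1 mul1r.
rewrite -sum_perm_fix -/(T i).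
rewrite (partition_big (fun t : 'S_n => t i) xpredT) //=.
rewrite (eq_bigr (fun=> T i)) => [|j _]; last by rewrite -(Tconst j).
by rewrite sumr_const card_ord mulr_natl.
Qed.

Lemma out_weight_noerr n (U : 'M[algC]_n) c f : (0 < n)%N -> c =1 (fun=> 0%N) ->
  out_weight U c f = `|per_on U [set: 'I_n] f| ^+ 2 / n`!%:R.
Proof.
move=> n_gt0 c0; rewrite /out_weight.
have -> : undup [seq c i | i <- enum 'I_n] = [:: 0%N].
  apply/perm_small_eq => //; apply: uniq_perm => // [|v]; first exact: undup_uniq.
  rewrite mem_undup inE; apply/mapP/eqP => [[i _ ->] | ->]; first exact: c0.
  by exists (Ordinal n_gt0); rewrite ?mem_enum ?c0.
rewrite big_seq1.
have -> : [set i | c i == 0%N] = [set: 'I_n] by apply/setP => i; rewrite !inE c0.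
by rewrite cardsT card_ord.
Qed.

Lemma out_weight_1err n (U : 'M[algC]_n) c f i : (1 < n)%N ->
    c i != 0%N -> (forall k, k != i -> c k = 0%N) ->
  out_weight U c f =
    `|U (f i) i| ^+ 2 * (`|per_on U [set~ i] f| ^+ 2 / (n.-1)`!%:R).
Proof.
move=> n_gt1 ci_neq0 c0; rewrite /out_weight.
(* An error-free photon exists, so the label 0 occurs and there are exactly two classes. *)
have [k k_neq] : exists k : 'I_n, k != i.
  apply/existsP; rewrite -negb_forall; apply/forallP => all_i.
  have : (#|[set: 'I_n]| <= #|[set i]|)%N.
    by apply/subset_leq_card/subsetP => x _; rewrite inE.
  by rewrite cardsT card_ord cards1 leqNgt n_gt1.
have classes : perm_eq (undup [seq c i | i <- enum 'I_n]) [:: c i; 0%N].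
  apply: uniq_perm => [||v]; rewrite ?undup_uniq //= ?inE ?andbT //.
  rewrite mem_undup; apply/mapP/orP => [[x _ ->] | [|] /eqP ->].
  - by have [->|/c0 ->] := eqVneq x i; [left | right].
  - by exists i; rewrite ?mem_enum.
  - by exists k; rewrite ?mem_enum ?c0.
rewrite (perm_big _ classes) /= big_cons big_seq1.
have -> : [set x | c x == c i] = [set i].
  apply/setP => x; rewrite !inE; have [->|x_neq] := eqVneq x i; first by rewrite eqxx.
  by rewrite c0 // eq_sym (negbTE ci_neq0).
have -> : [set x | c x == 0%N] = [set~ i].
  apply/setP => x; rewrite !inE; have [->|x_neq] := eqVneq x i; first exact/negbTE.
  by rewrite c0 // eqxx.
rewrite cards1 factS fact0 divr1 cardsC1 card_ord; congr (`|_| ^+ 2 * _).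
rewrite /per_on (eq_bigl (pred1 1%g)) => [|t].
  by rewrite big_pred1_eq big_set1 perm1.
by apply/idP/eqP => [/perm_on_id -> | ->]; rewrite ?cards1 ?perm_on1.
Qed.

(** By [per_ideal] and flatness, the squared full permanent is [n] times the squared permanent
    without photon [i]. This [n] cancels in [n!], and the entry of the faulty photon supplies the
    factor [1/n]. *)
Lemma out_weight_ideal n (U : 'M[algC]_n) c f i : (1 < n)%N ->
    c i != 0%N -> (forall k, k != i -> c k = 0%N) ->
    flat_symmetric U -> ideal_pattern U f ->
  out_weight U c f = (`|per_on U [set: 'I_n] f| ^+ 2 / n`!%:R) / n%:R.
Proof.
move=> n_gt1 ci_neq0 c0 symU ideal_f; have [_ flatU _] := symU.
rewrite (out_weight_1err U f n_gt1 ci_neq0 c0) (per_ideal i symU ideal_f).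
rewrite !normrM !exprMn flatU normr_nat.
rewrite -[in n`!](prednK (ltnW n_gt1)) factS natrM prednK 1?ltnW //.
have n_neq0 : n%:R != 0 :> algC by rewrite pnatr_eq0 -lt0n ltnW.
have fact_neq0 : (n.-1)`!%:R != 0 :> algC by rewrite pnatr_eq0 -lt0n fact_gt0.
by field; rewrite n_neq0 fact_neq0.
Qed.

Definition only_at n (m0 i : 'I_n) (f : {ffun 'I_n -> 'I_n}) : bool :=
  [set j | f j == m0] == [set i].

Definition single_weight n (U : 'M[algC]_n) (m0 i : 'I_n) : algC :=
  \sum_(f | only_at m0 i f) `|per_on U [set: 'I_n] f| ^+ 2 / n`!%:R.

(* Expanding |per|^2 and summing over the output modes of the photons other
   than i, orthonormality of the columns leaves only entries of row m0. *)
Lemma single_weight_row n (U U' : 'M[algC]_n) (m0 i : 'I_n) :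
    flat_symmetric U -> flat_symmetric U' -> (forall j, U m0 j = U' m0 j) ->
  single_weight U m0 i = single_weight U' m0 i.
Proof.
move=> [orthU _ _] [orthU' _ _] rowU.
(* Photon [i] being alone in [m0] is a condition on each photon separately, so the sum over [f]
   factors into one sum over [Q a] per photon. *)
pose Q (a : 'I_n) : pred 'I_n := [pred j | (j == m0) == (a == i)].
have sumQ (V : 'M[algC]_n) (orthV : forall x y, \sum_j V j x * (V j y)^* = (x == y)%:R) a x y :
    \sum_(j | Q a j) V j x * (V j y)^* =
    if a == i then V m0 x * (V m0 y)^* else (x == y)%:R - V m0 x * (V m0 y)^*.
  case: ifP => ai; rewrite -?orthV /Q ai.
    by rewrite (eq_bigl (pred1 m0)) ?big_pred1_eq // => j; rewrite inE eqb_id.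
  rewrite [X in _ = X - _](bigD1 m0) //= addrAC subrr add0r.
  by apply: eq_bigl => j; rewrite eqbF_neg.
have only_atE f : only_at m0 i f = (f \in family Q).
  apply/eqP/familyP => [fi a | fQ].
    by rewrite inE; move/setP/(_ a): fi; rewrite !inE => ->.
  by apply/setP => a; have := fQ a; rewrite !inE => /eqP.
have expand (V : 'M[algC]_n) : single_weight V m0 i =
    (\sum_(t : 'S_n) \sum_(t' : 'S_n)
      (\prod_a \sum_(j | Q a j) V j (t a) * (V j (t' a))^*)) / n`!%:R.
  rewrite /single_weight -mulr_suml; congr (_ / _).
  transitivity (\sum_(f in family Q) \sum_(t : 'S_n) \sum_(t' : 'S_n)
      \prod_a (V (f a) (t a) * (V (f a) (t' a))^*)).
    apply: eq_big => [f | f _]; first exact: only_atE.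
    rewrite normCK per_on_setT rmorph_sum mulr_suml; apply: eq_bigr => t _.
    rewrite mulr_sumr; apply: eq_bigr => t' _.
    by rewrite rmorph_prod -big_split.
  rewrite exchange_big; apply: eq_bigr => t _; rewrite exchange_big.
  by apply: eq_bigr => t' _; rewrite bigA_distr_big_dep.
rewrite !expand; congr (_ / _); apply: eq_bigr => t _; apply: eq_bigr => t' _.
by apply: eq_bigr => a _; rewrite !sumQ // !rowU.
Qed.

Lemma sum_success n (U : 'M[algC]_n) m0 (P : pred {ffun 'I_n -> 'I_n}) :
  \sum_(f : {ffun 'I_n -> 'I_n} | success U m0 f && P f)
     `|per_on U [set: 'I_n] f| ^+ 2 / n`!%:R
  = \sum_i \sum_(f | only_at m0 i f && P f)
     `|per_on U [set: 'I_n] f| ^+ 2 / n`!%:R.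
Proof.
rewrite (exchange_big_dep (fun f => P f && (#|[set j | f j == m0]| == 1%N))) /=; last first.
  by move=> i f _ /andP[/eqP -> ->]; rewrite cards1.
rewrite big_mkcond [RHS]big_mkcond; apply: eq_bigr => f _.
rewrite /success; case: (P f); rewrite ?andbF ?andbT //=.
case: cards1P => //= -[k fk]; rewrite (big_pred1 k) => [|i]; last first.
  by rewrite /only_at fk andbT eq_sym (inj_eq set1_inj).
by case: ifP => // /negbFE /eqP ->; rewrite normr0 expr0n mul0r.
Qed.

(** * Success and error probabilities with at most one faulty photon *)

Section AtMostOneError.

Variables (n : nat) (U U' : 'M[algC]_n) (m0 : 'I_n).
Hypothesis n_gt1 : (1 < n)%N.
Hypotheses (symU : flat_symmetric U) (symU' : flat_symmetric U').
Hypothesis rowU : forall j, U m0 j = U' m0 j.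

Lemma errors_le1 (c : 'I_n -> nat) : (#|[set i | c i != 0%N]| <= 1)%N ->
  c =1 (fun=> 0%N) \/
  exists i, c i != 0%N /\ forall k, k != i -> c k = 0%N.
Proof.
rewrite leq_eqVlt ltnS leqn0 => /orP[/cards1P[i ci] | /eqP/cards0_eq c0].
  right; exists i; split; first by have /setP/(_ i) := ci; rewrite !inE eqxx.
  by move=> k /negbTE k_neq; have /setP/(_ k) := ci; rewrite !inE k_neq => /negbFE/eqP.
by left=> i; have /setP/(_ i) := c0; rewrite !inE => /negbFE/eqP.
Qed.

(** The factor [r], either 1 or [1/n], is chosen before the unitary and the pattern, so it is common
    to [U] and [U']. *)
Lemma out_weight_prop (c : 'I_n -> nat) : (#|[set i | c i != 0%N]| <= 1)%N ->
  exists r : algC, forall (V : 'M[algC]_n) f, flat_symmetric V ->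
    success V m0 f ->
    out_weight V c f = `|per_on V [set: 'I_n] f| ^+ 2 / n`!%:R * r.
Proof.
case/errors_le1 => [c0 | [i [ci c0]]].
  by exists 1 => V f _ _; rewrite out_weight_noerr 1?ltnW ?mulr1.
exists n%:R^-1 => V f symV /andP[_ idealf].
exact: out_weight_ideal ci c0 symV idealf.
Qed.

Lemma succ_prob_row (c : 'I_n -> nat) : (#|[set i | c i != 0%N]| <= 1)%N ->
  succ_prob U m0 c = succ_prob U' m0 c.
Proof.
move=> /out_weight_prop[r weightE].
have reduce (V : 'M[algC]_n) : flat_symmetric V ->
    succ_prob V m0 c = (\sum_i single_weight V m0 i) * r.
  move=> symV; rewrite /succ_prob (eq_bigr _ (fun f : {ffun _} => weightE V f symV)) -mulr_suml.
  under eq_bigl do rewrite -[success _ _ _]andbT.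
  rewrite (sum_success V m0 xpredT); congr (_ * r); apply: eq_bigr => i _.
  by apply: eq_bigl => f; rewrite andbT.
rewrite !reduce //; congr (_ * r); apply: eq_bigr => i _.
exact: single_weight_row.
Qed.

Lemma succ_err_prob_row (c : 'I_n -> nat) : (#|[set i | c i != 0%N]| <= 1)%N ->
  succ_err_prob U m0 c = succ_err_prob U' m0 c.
Proof.
move=> /out_weight_prop[r weightE].
have reduce (V : 'M[algC]_n) : flat_symmetric V ->
    succ_err_prob V m0 c = (\sum_(i | c i != 0%N) single_weight V m0 i) * r.
  move=> symV; rewrite /succ_err_prob.
  rewrite (eq_bigr (fun f : {ffun 'I_n -> 'I_n} => `|per_on V [set: 'I_n] f| ^+ 2 / n`!%:R * r)); last first.
    by move=> f /andP[sf _]; exact: weightE.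
  rewrite -mulr_suml sum_success; congr (_ * r); rewrite [RHS]big_mkcond.
  have errE i (f : {ffun 'I_n -> 'I_n}) : only_at m0 i f -> out_error c m0 f = (c i != 0%N).
    move=> /eqP/setP fi; apply/existsP/idP => [[k /andP[fk ck]]|ci].
      by have := fi k; rewrite !inE fk => /esym/eqP <-.
    by exists i; have := fi i; rewrite !inE eqxx => ->.
  apply: eq_bigr => i _; rewrite /single_weight; case: ifP => ci.
    apply: eq_bigl => f; case E : (only_at m0 i f) => //=.
    by rewrite (errE _ _ E).
  rewrite big_pred0 // => f; case E : (only_at m0 i f) => //=.
  by rewrite (errE _ _ E).
rewrite !reduce //; congr (_ * r); apply: eq_bigr => i _.
exact: single_weight_row.
Qed.

End AtMostOneError.

(** * First-order expansion *)

Lemma dvdp_prod_set (R : fieldType) (I : finType) (A : {set I}) (d : {poly R}) F :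
  (forall i, i \in A -> d %| F i) -> d ^+ #|A| %| \prod_i F i.
Proof.
move=> dF; rewrite (bigID (mem A)) /= dvdp_mulr // -prodr_const.
by apply: (big_ind2 (fun p q => p %| q)) => // p q p' q'; apply: dvdp_mul.
Qed.

(** Each faulty photon puts a factor ['X] into the probability of its configuration, so two or more
    faults vanish modulo ['X ^+ 2]. *)
Lemma weighted_first_order n (src : source) (F F' : ('I_n -> nat) -> algC) :
    (forall c, (#|[set i | c i != 0%N]| <= 1)%N -> F c = F' c) ->
  first_order_eq (weighted src F) (weighted src F').
Proof.
have dvdX2 (w : {poly algC}) (A : {set 'I_n}) (a b : algC) :
    'X ^+ #|A| %| w -> ((#|A| <= 1)%N -> a = b) ->
    'X ^+ 2 %| w * a%:P - w * b%:P.
  move=> w_dvd; have [_ -> // | A_gt1 _] := leqP #|A| 1; first by rewrite subrr dvdp0.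
  by rewrite -mulrBr dvdp_mulr // (dvdp_trans _ w_dvd) // dvdp_exp2l.
move=> FF'; rewrite /first_order_eq; case: src => [|R] /=; rewrite -sumrB.
  apply: (big_ind (fun p => 'X ^+ 2 %| p)) => [|p q|E _]; [exact: dvdp0 | exact: dvdp_add |].
  apply: (dvdX2 _ E); first by rewrite dvdp_mulr.
  move=> E1; apply: FF'; congr (_ <= _)%N: E1; apply: eq_card => i.
  by rewrite inE /obb_label; case: (i \in E).
apply: (big_ind (fun p => 'X ^+ 2 %| p)) => [|p q|c _]; [exact: dvdp0 | exact: dvdp_add |].
apply: (dvdX2 _ [set i | c i != ord0]); last exact: FF'.
apply: dvdp_prod_set => i; rewrite inE => /negbTE ->.
by rewrite -mul_polyC dvdp_mull.
Qed.

Lemma first_order_eq_ratioP (p1 q1 p2 q2 : {poly algC}) :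
  first_order_eq p1 p2 -> first_order_eq q1 q2 -> first_order_eq_ratio p1 q1 p2 q2.
Proof.
rewrite /first_order_eq /first_order_eq_ratio => dp dq.
have -> : p1 * q2 - p2 * q1 = (p1 - p2) * q2 - p2 * (q1 - q2) by ring.
by apply: dvdp_sub; [apply: dvdp_mulr | apply: dvdp_mull].
Qed.

(** * Tensor products of Fourier matrices *)

Lemma omega_norm m : (1 < m)%N -> `|omega m| = 1.
Proof.
move=> m_gt1; apply/eqP; rewrite -(@pexpr_eq1 _ _ m) 1?ltnW // -normrX.
by rewrite (prim_expr_order (prim_root_omega m_gt1)) normr1.
Qed.

Lemma omegaX_conj m k : (1 < m)%N -> (omega m ^+ k)^* = (omega m ^+ k)^-1.
Proof. by move=> m_gt1; rewrite [RHS]invC_norm normrX omega_norm // !expr1n invr1 mul1r. Qed.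

(** The terms are [z ^+ j / m] for an [m]-th root of unity [z], and the geometric sum vanishes
    unless [z] is 1. *)
Lemma Fmx_orthonormal m x y : (1 < m)%N ->
  \sum_j Fmx m j x * (Fmx m j y)^* = (x == y)%:R.
Proof.
move=> m_gt1; have prim := prim_root_omega m_gt1.
have w_neq0 : omega m != 0 by rewrite -normr_eq0 omega_norm // oner_eq0.
have wy_neq0 : omega m ^+ y != 0 by apply: expf_neq0.
have m_neq0 : m%:R != 0 :> algC by rewrite pnatr_eq0 -lt0n ltnW.
pose z := omega m ^+ x / omega m ^+ y.
have entryE j : Fmx m j x * (Fmx m j y)^* = z ^+ j / m%:R.
  rewrite !mxE rmorphM /= omegaX_conj // fmorphV /= (CrealP _); last first.
    by rewrite ger0_real // sqrtC_ge0 ler0n.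
  rewrite mulrACA -invfM -expr2 sqrtCK; congr (_ / _).
  by rewrite [RHS]expr_div_n -!exprM [(x * j)%N]mulnC [(y * j)%N]mulnC.
rewrite (eq_bigr _ (fun j _ => entryE j)) -mulr_suml.
have [exy|neq_xy] := eqVneq x y.
  have z1 : z = 1 by rewrite /z exy divff.
  rewrite (eq_bigr (fun=> 1)) => [|j _]; last by rewrite z1 expr1n.
  by rewrite sumr_const card_ord divff.
have z1 : z - 1 != 0.
  rewrite subr_eq0; apply: contra neq_xy => /eqP zE.
  have : omega m ^+ x == omega m ^+ y.
    by rewrite -(inj_eq (divIf wy_neq0)) -/z zE divff.
  by rewrite (eq_prim_root_expr prim) !modn_small.
suff -> : \sum_(j < m) z ^+ j = 0 by rewrite mul0r.
apply: (mulfI z1); rewrite mulr0 -subrX1 exprMn exprVn -!exprM ![(_ * m)%N]mulnC.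
by rewrite !exprM (prim_expr_order prim) !expr1n invr1 mulr1 subrr.
Qed.

Lemma Fmx_flat m i j : (1 < m)%N -> `|Fmx m i j| ^+ 2 = m%:R^-1.
Proof.
move=> m_gt1; rewrite mxE normrM normrX omega_norm // expr1n mul1r normfV exprVn.
by rewrite ger0_norm ?sqrtCK // sqrtC_ge0 ler0n.
Qed.

(** * Cyclic shifts and column symmetries *)

Definition shift m : 'S_m := perm (@ordS_inj m).

Lemma shiftX m k (i : 'I_m) : (shift m ^+ k)%g i = ((i + k) %% m)%N :> nat.
Proof.
elim: k => [|k IHk]; first by rewrite expg0 perm1 addn0 modn_small.
by rewrite expgSr permM permE /= IHk -addn1 modnDml addn1 addnS.
Qed.

Lemma order_shift m : (0 < m)%N -> #[shift m]%g = m.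
Proof.
move=> m_gt0; apply/eqP; rewrite eqn_dvd order_dvdn; apply/andP; split.
  by apply/eqP/permP => i; apply: val_inj; rewrite /= shiftX perm1 modnDr modn_small.
have := shiftX #[shift m]%g (Ordinal m_gt0); rewrite expg_order perm1 /= add0n.
by move/esym/eqP.
Qed.

(** The exponent represents [k - j] modulo [m] without truncated subtraction. *)
Lemma shift_trans m (j k : 'I_m) : (shift m ^+ (k + (m - j)))%g j = k.
Proof.
apply: val_inj; rewrite /= shiftX addnCA subnKC 1?ltnW //.
by rewrite modnDr modn_small.
Qed.

(** Moving one column on multiplies row [i] by [omega m ^+ i]; the wrap-around is harmless since
    [omega m ^+ m = 1]. *)
Lemma shift_symmetry m : (1 < m)%N -> column_symmetry (Fmx m) (shift m).
Proof.
move=> m_gt1; exists (fun i => omega m ^+ i) => i x.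
rewrite !mxE permE /= mulrA; congr (_ / _).
rewrite exprM expr_mod; first by rewrite exprS -exprM.
by rewrite exprAC (prim_expr_order (prim_root_omega m_gt1)) expr1n.
Qed.

Lemma column_symmetryM n (U : 'M[algC]_n) p q :
  column_symmetry U p -> column_symmetry U q -> column_symmetry U (p * q)%g.
Proof.
move=> [d Up] [e Uq]; exists (fun i => e i * d i) => i x.
by rewrite permM Uq Up mulrA.
Qed.

Lemma column_symmetry1 n (U : 'M[algC]_n) : column_symmetry U 1%g.
Proof. by exists (fun=> 1) => i x; rewrite perm1 mul1r. Qed.

Lemma column_symmetryX n (U : 'M[algC]_n) p k :
  column_symmetry U p -> column_symmetry U (p ^+ k)%g.
Proof.
move=> Up; elim: k => [|k IHk]; first exact: column_symmetry1.
by rewrite expgS; apply: column_symmetryM.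
Qed.

(** * Permutations acting on the two factors of a tensor product *)

Section TensorPerm.

Variables m n : nat.
Implicit Types (s : 'S_m) (t : 'S_n).

Definition tens_fun s t (k : 'I_(m * n)) : 'I_(m * n) :=
  mxtens_index (s (mxtens_unindex k).1, t (mxtens_unindex k).2).

Lemma tens_fun_inj s t : injective (tens_fun s t).
Proof.
move=> k l; case: (mxtens_indexP k) => i j; case: (mxtens_indexP l) => i' j'.
move/(can_inj (@mxtens_indexK m n)).
by rewrite !mxtens_indexK /= => -[/perm_inj -> /perm_inj ->].
Qed.

Definition tens_perm s t : 'S_(m * n) := perm (@tens_fun_inj s t).

Lemma tens_permE s t i j :
  tens_perm s t (mxtens_index (i, j)) = mxtens_index (s i, t j).
Proof. by rewrite permE /tens_fun mxtens_indexK. Qed.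

Lemma tens_permM s1 s2 t1 t2 :
  tens_perm (s1 * s2)%g (t1 * t2)%g = (tens_perm s1 t1 * tens_perm s2 t2)%g.
Proof.
by apply/permP => k; case: (mxtens_indexP k) => i j; rewrite permM !tens_permE !permM.
Qed.

Definition tensl_perm s := tens_perm s 1%g.
Definition tensr_perm t := tens_perm 1%g t.

Lemma tensl_permM : {in [set: 'S_m] &, {morph tensl_perm : s1 s2 / (s1 * s2)%g}}.
Proof. by move=> s1 s2 _ _; rewrite /tensl_perm -tens_permM mulg1. Qed.

Lemma tensr_permM : {in [set: 'S_n] &, {morph tensr_perm : t1 t2 / (t1 * t2)%g}}.
Proof. by move=> t1 t2 _ _; rewrite /tensr_perm -tens_permM mulg1. Qed.

Canonical tensl_morphism := Morphism tensl_permM.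
Canonical tensr_morphism := Morphism tensr_permM.

Hypotheses (m_gt0 : (0 < m)%N) (n_gt0 : (0 < n)%N).

Lemma tens_perm_inj s1 t1 s2 t2 :
  tens_perm s1 t1 = tens_perm s2 t2 -> s1 = s2 /\ t1 = t2.
Proof.
move=> eq_st.
have eq_ij i j : (s1 i, t1 j) = (s2 i, t2 j).
  by apply: (can_inj (@mxtens_indexK m n)); rewrite -!tens_permE eq_st.
split; apply/permP; first by move=> i; have [] := eq_ij i (Ordinal n_gt0).
by move=> j; have [] := eq_ij (Ordinal m_gt0) j.
Qed.

Lemma injm_tensl : ('injm tensl_perm)%g.
Proof. by apply/injmP => s1 s2 _ _ /tens_perm_inj[]. Qed.

Lemma injm_tensr : ('injm tensr_perm)%g.
Proof. by apply/injmP => t1 t2 _ _ /tens_perm_inj[]. Qed.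

(** The images act on different factors, hence commute, and meet trivially by [tens_perm_inj]; so
    the partial product [\x] is defined here. *)
Lemma tens_dprod (G : {group 'S_m}) (H : {group 'S_n}) :
  (tensl_perm @* G \x tensr_perm @* H = (tensl_perm @* G) <*> (tensr_perm @* H))%g.
Proof.
apply: dprodEY.
  apply/centsP => _ /morphimP[t _ _ ->] _ /morphimP[s _ _ ->].
  by rewrite /commute /= /tensl_perm /tensr_perm -!tens_permM !mulg1 !mul1g.
apply/trivgP/subsetP => _ /setIP[/morphimP[s _ _ ->] /morphimP[t _ _]].
by case/tens_perm_inj => -> _; rewrite -/(tensl_perm 1) morph1 inE.
Qed.

Lemma mem_tens (G : {group 'S_m}) (H : {group 'S_n}) p :
  reflect (exists s t, [/\ s \in G, t \in H & p = tens_perm s t])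
          (p \in (tensl_perm @* G) <*> (tensr_perm @* H))%g.
Proof.
have /dprodP[_ <- _ _] := tens_dprod G H.
apply: (iffP mulsgP) => [[_ _ /morphimP[s _ Gs ->] /morphimP[t _ Ht ->] ->]|].
  by exists s, t; split=> //=; rewrite /tensl_perm /tensr_perm -tens_permM mulg1 mul1g.
move=> [s [t [Gs Ht ->]]]; exists (tensl_perm s) (tensr_perm t).
- by apply: mem_morphim; rewrite ?inE.
- by apply: mem_morphim; rewrite ?inE.
by rewrite /tensl_perm /tensr_perm -tens_permM mulg1 mul1g.
Qed.

End TensorPerm.

Lemma column_symmetry_tens m n (A : 'M[algC]_m) (B : 'M[algC]_n) s t :
    column_symmetry A s -> column_symmetry B t ->
  column_symmetry (tensmx A B) (tens_perm s t).
Proof.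
move=> [d As] [e Bt].
exists (fun i => d (mxtens_unindex i).1 * e (mxtens_unindex i).2) => i x.
by rewrite !mxE permE /tens_fun mxtens_indexK /= As Bt mulrACA.
Qed.

(** * Symmetry group, orthonormality and first row of [Ften] *)

Definition size_ge2 (s : seq nat) := all (fun k => 2 <= k)%N s.

Lemma prodn_gt0 s : size_ge2 s -> (0 < prodn s)%N.
Proof.
elim: s => //= m s IHs /andP[m_gt1 /IHs s_gt0].
by rewrite muln_gt0 s_gt0 andbT ltnW.
Qed.

Lemma Ften_group s : size_ge2 s ->
  exists (G : {group 'S_(prodn s)}) (x : 'I_(size s) -> 'S_(prodn s)),
    [/\ forall t, #[x t]%g = nth 0%N s t,
        (\big[dprod/1%g]_(t < size s) <[x t]>%g)%g = G,
        abelian G,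
        forall P, P \in G -> column_symmetry (Ften s) P
      & forall j k, exists2 P : 'S_(prodn s), P \in G & P j = k].
Proof.
elim: s => [_ | m s IHs /= /andP[m_gt1 s_ge2]].
  exists 1%G, (fun=> 1%g); split=> [[] //||||j k] /=.
  - by rewrite big_ord0.
  - exact: abelian1.
  - by move=> _ /set1P ->; apply: column_symmetry1.
  by exists 1%g; rewrite // !ord1.
have {IHs} [G [x [ox defG cGG symG transG]]] := IHs s_ge2.
have m_gt0 := ltnW m_gt1; have s_gt0 := prodn_gt0 s_ge2.
have injl := injm_tensl m_gt0 s_gt0; have injr := injm_tensr m_gt0 s_gt0.
pose tl := @tensl_perm m (prodn s); pose tr := @tensr_perm m (prodn s).
exists ((tl @* <[shift m]>) <*> (tr @* G))%G.
(* Index 0 gets the shift on the new factor; the later ones get the old generators, lifted. *)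
exists (fun t => if unlift ord0 t is Some t' then tr (x t') else tl (shift m)).
split=> [t||||j k] /=.
- case: unliftP => [t' ->|->] /=.
    by rewrite order_injm ?inE ?ox.
  by rewrite order_injm ?inE ?order_shift.
- rewrite big_ord_recl unlift_none -tens_dprod //.
  congr (_ \x _)%g; first by rewrite morphim_cycle ?inE.
  rewrite -(injm_bigdprod (subsetT G) injr defG); apply: eq_bigr => t _.
  by rewrite liftK morphim_cycle ?inE.
- have [_ _ cent _] := dprodP (tens_dprod m_gt0 s_gt0 <[shift m]> G).
  by rewrite abelianY cent !morphim_abelian // cycle_abelian.
- move=> P /mem_tens[] // p [q [/cycleP[k ->] Gq ->]].
  apply: column_symmetry_tens; last exact: symG.
  by apply: column_symmetryX; apply: shift_symmetry.
case: (mxtens_indexP j) => j1 j2; case: (mxtens_indexP k) => k1 k2.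
have [q Gq qj] := transG j2 k2.
exists (tens_perm (shift m ^+ (k1 + (m - j1)))%g q).
  by apply/mem_tens => //; exists (shift m ^+ (k1 + (m - j1)))%g, q; rewrite mem_cycle.
by rewrite tens_permE shift_trans qj.
Qed.

Lemma Ften_orthonormal s x y : size_ge2 s ->
  \sum_j Ften s j x * (Ften s j y)^* = (x == y)%:R.
Proof.
elim: s x y => [x y _ | m s IHs x y /= /andP[m_gt1 s_ge2]].
  by rewrite big_ord1 !ord1 !mxE eqxx mul1r rmorph1.
case: (mxtens_indexP x) => x1 x2; case: (mxtens_indexP y) => y1 y2.
transitivity ((\sum_j Fmx m j x1 * (Fmx m j y1)^*) *
              (\sum_j Ften s j x2 * (Ften s j y2)^*)).
  by rewrite mulr_sum; apply: eq_bigr => j _; rewrite !mxE !mxtens_indexK rmorphM mulrACA.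
rewrite Fmx_orthonormal // IHs // -natrM mulnb; congr (nat_of_bool _)%:R.
by rewrite (can_eq (@mxtens_indexK m (prodn s))) -xpair_eqE.
Qed.

Lemma Ften_flat s i j : size_ge2 s -> `|Ften s i j| ^+ 2 = (prodn s)%:R^-1.
Proof.
elim: s i j => [i j _ | m s IHs i j /= /andP[m_gt1 s_ge2]].
  by rewrite !ord1 mxE eqxx normr1 expr1n invr1.
by rewrite mxE normrM exprMn Fmx_flat // IHs // natrM invfM.
Qed.

Lemma Ften_flat_symmetric s : size_ge2 s -> flat_symmetric (Ften s).
Proof.
move=> s_ge2; split=> [x y|i j|j k]; [exact: Ften_orthonormal | exact: Ften_flat |].
have [G [_ [_ _ _ symG /(_ j k)[P GP Pj]]]] := Ften_group s_ge2.
by exists P; split=> //; apply: symG.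
Qed.

(** Index 0 splits into index 0 of both factors, where every exponent of [omega] is 0. *)
Lemma Ften_row0 s (i j : 'I_(prodn s)) : val i = 0%N ->
  Ften s i j = (sqrtC (prodn s)%:R)^-1.
Proof.
elim: s i j => [i j _ | m s IHs i j /= i0].
  by rewrite !ord1 mxE eqxx sqrtC1 invr1.
rewrite !mxE IHs /= ?i0 ?mod0n // div0n mul0n expr0 div1r natrM.
by rewrite rootCMl ?ler0n // invfM.
Qed.

(** * Relabelling the modes and comparing the rates *)

Lemma relabelE n (sigma : 'S_n) (U : 'M[algC]_n) i j :
  relabel sigma U i j = U (sigma i) (sigma j).
Proof. by rewrite /relabel tr_perm_mx -row_permE -col_permE !mxE. Qed.

Lemma relabel_flat_symmetric n (sigma : 'S_n) (U : 'M[algC]_n) :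
  flat_symmetric U -> flat_symmetric (relabel sigma U).
Proof.
move=> [orthU flatU symU]; split=> [x y|i j|j k].
- under eq_bigr do rewrite !relabelE.
  rewrite -(inj_eq (@perm_inj _ sigma)) -orthU [RHS](reindex_inj (@perm_inj _ sigma)).
  by [].
- by rewrite relabelE flatU.
have [p [pj [d Up]]] := symU (sigma j) (sigma k).
(* Products of permutations apply the left factor first. *)
exists (sigma * p * sigma^-1)%g; split; first by rewrite !permM pj permK.
by exists (fun i => d (sigma i)) => i x; rewrite !relabelE !permM permKV Up.
Qed.

Lemma first_order_rates n (U U' : 'M[algC]_n) (m0 m0' : 'I_n) (src : source) :
    (1 < n)%N -> flat_symmetric U -> flat_symmetric U' -> m0 = m0' ->
    (forall j, U m0 j = U' m0 j) ->
  first_order_eq (herald_rate src U m0) (herald_rate src U' m0')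
  /\ first_order_eq_ratio (herald_err src U m0) (herald_rate src U m0)
                          (herald_err src U' m0') (herald_rate src U' m0').
Proof.
move=> n_gt1 symU symU' <- rowU.
have rate : first_order_eq (herald_rate src U m0) (herald_rate src U' m0).
  by apply: weighted_first_order => c; apply: succ_prob_row.
split=> //; apply: first_order_eq_ratioP => //.
by apply: weighted_first_order => c; apply: succ_err_prob_row.
Qed.

Theorem theorem9 :
  (forall s : seq nat, all (fun k => 2 <= k)%N s -> (2 <= prodn s)%N ->
    exists sigma : 'S_(prodn s),
      let U := relabel sigma (Ften s) in
      (* (1) first row constant 1/sqrt n *)
      (forall i j : 'I_(prodn s), val i = 0%N -> U i j = (sqrtC (prodn s)%:R)^-1)
      /\
      exists G : {group 'S_(prodn s)},
        (* (2) G ~= Z_{n_1} x ... x Z_{n_l}, abelian, symmetry group of U *)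
        (exists x : 'I_(size s) -> 'S_(prodn s),
            (forall t : 'I_(size s), #[x t]%g = nth 0%N s t) /\
            (\big[dprod/1%g]_(t < size s) <[x t]>%g)%g = G)
        /\ abelian G
        /\ (forall P : 'S_(prodn s), P \in G ->
              exists d : 'rV[algC]_(prodn s), U *m perm_mx P = diag_mx d *m U)
        (* (3) transitivity on the modes *)
        /\ [transitive G, on [set: 'I_(prodn s)] | 'P])
  /\
  (* In particular: first-order heralding and error rates depend only on n *)
  (forall s s' : seq nat,
     all (fun k => 2 <= k)%N s -> all (fun k => 2 <= k)%N s' ->
     (2 <= prodn s)%N -> prodn s = prodn s' ->
     forall (sigma : 'S_(prodn s)) (sigma' : 'S_(prodn s'))
            (m0 : 'I_(prodn s)) (m0' : 'I_(prodn s')),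
     val m0 = 0%N -> val m0' = 0%N ->
     (forall j, relabel sigma (Ften s) m0 j = (sqrtC (prodn s)%:R)^-1) ->
     (forall j, relabel sigma' (Ften s') m0' j = (sqrtC (prodn s')%:R)^-1) ->
     forall src : source, valid_source src ->
       first_order_eq (herald_rate src (relabel sigma (Ften s)) m0)
                      (herald_rate src (relabel sigma' (Ften s')) m0')
       /\ first_order_eq_ratio
            (herald_err src (relabel sigma (Ften s)) m0)
            (herald_rate src (relabel sigma (Ften s)) m0)
            (herald_err src (relabel sigma' (Ften s')) m0')
            (herald_rate src (relabel sigma' (Ften s')) m0')).
Proof.
split=> [s s_ge2 s_gt1 | s s' s_ge2 s'_ge2 s_gt1 eq_n sigma sigma' m0 m0' z z' row row' src _].
  exists 1%g; rewrite /relabel perm_mx1 mul1mx trmx1 mulmx1 /=.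
  split=> [i j|]; first exact: Ften_row0.
  have [G [x [ox defG cGG symG transG]]] := Ften_group s_ge2.
  exists G; split; first by exists x.
  split=> //; split=> [P GP|].
    (* Right multiplication by [perm_mx P] permutes the columns by the inverse of [P]. *)
    have [d UP] := symG _ (groupVr GP); exists (\row_i d i).
    by rewrite -[P]invgK -col_permE mul_diag_mx; apply/matrixP => i j; rewrite !mxE UP.
  pose j0 := Ordinal (ltnW s_gt1).
  apply/imsetP; exists j0; rewrite ?inE //; apply/setP => k; rewrite inE.
  have [P GP Pj] := transG j0 k.
  by apply/esym/orbitP; exists P.
have symU := relabel_flat_symmetric sigma (Ften_flat_symmetric s_ge2).
have symU' := relabel_flat_symmetric sigma' (Ften_flat_symmetric s'_ge2).
move: (relabel sigma' _) symU' row'; move: (relabel sigma _) symU row.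
(* With both matrices generalized, eliminating [eq_n] gives them the same type. *)
move: m0' z' {sigma' s'_ge2}; case: _ / eq_n => m0' z' U symU row U' symU' row'.
have eq_m : m0 = m0' by apply: val_inj; rewrite z z'.
by apply: first_order_rates => // j; rewrite row eq_m row'.
Qed.
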